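(* Let $N$ be a network and $X\subseteq\Phi(N)$ any set of formulas, and let ${\cal P}_0$ be the protocol over $N$ constructed from $N$ and $X$ as described in the context. For any sets of channels $A,B\subseteq Ch(N)$, if $A$ functionally determines $B$ with respect to ${\cal P}_0$, then $X\vdash_N A\rhd B$.
   Context: A network $N$ is a finite undirected graph (loops and multiple edges allowed) whose vertices are parties and whose edges, called channels, are labeled by secret variables; $Ch(N)$ is the set of channels and $Inc(p)$ the set of channels incident with party $p$. A semi-protocol over $N$ assigns to each channel $c$ a set $V(c)$ of values and to each party $p$ a predicate $L_p$ on the values of the channels in $Inc(p)$; a run is a function $r$ with $r(c)\in V(c)$ for all $c$ satisfying all $L_p$; a protocol is a semi-protocol with at least one run. $A$ functionally determines $B$ w.r.t. a protocol if any two runs agreeing on all channels of $A$ agree on all channels of $B$. A path is a sequence of channels forming an undirected walk; $G$ is a gateway between $A$ and $B$ if every path starting in $A$ and ending in $B$ contains a channel of $G$. $\Phi(N)$ is the smallest set of formulas containing $A\rhd B$ for finite sets of channels $A,B$, the constant $\bot$, and closed under $\to$. The Logic of Secrets for $N$: propositional tautologies, Modus Ponens, and axioms Reflexivity ($A\rhd B$ if $A\supseteq B$), Augmentation ($A\rhd B\to A\cup C\rhd B\cup C$), Transitivity ($A\rhd B\to(B\rhd C\to A\rhd C)$), Gateway ($A\rhd B\to G\rhd B$ if $G$ is a gateway between $A$ and $B$ in $N$); $X\vdash_N\psi$ means derivability from $X$. For $E\subseteq Ch(N)$ let $E^*=\{c\in Ch(N): X\vdash_N E\rhd\{c\}\}$.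 Protocol ${\cal P}_0$: for each channel $c$, $V(c)$ is the set of functions $f:2^{Ch(N)}\to\{0,1\}$ such that $f(E)=0$ whenever $c\in E^*$; writing $r(c,E)$ for $r(c)(E)$, the local condition at party $p$ is: for all $E\subseteq Ch(N)$ and all $c,d\in Inc(p)\setminus E^*$, $r(c,E)=r(d,E)$. (The constant-zero assignment is a run, so ${\cal P}_0$ is a protocol.) *)

(* Defs.v *)
From mathcomp Require Import all_boot.
From mathcomp Require Import boolp classical_sets.

Set Implicit Arguments.
Unset Strict Implicit.
Unset Printing Implicit Defensive.

(* A channel has one end if it is a loop and two otherwise; since [channel] is
   a type of its own, several channels may have the same ends. *)
Record network := Network {
  party : finType;
  channel : finType;
  ends : channel -> {set party};
  card_ends : forall c, 0 < #|ends c| <= 2 }.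

Definition Inc (N : network) (p : party N) : {set channel N} :=
  [set c | p \in ends c].

Record semi_protocol (N : network) := SemiProtocol {
  value : channel N -> Type;
  local : forall p : party N,
    (forall c : {c : channel N | c \in Inc p}, value (sval c)) -> Prop }.

Definition is_run (N : network) (P : semi_protocol N)
    (r : forall c, value P c) : Prop :=
  forall p : party N,
    @local N P p (fun c : {c : channel N | c \in Inc p} => r (sval c)).

Record protocol (N : network) := Protocol {
  semi :> semi_protocol N;
  has_run : exists r, is_run (P := semi) r }.

Definition determines (N : network) (P : protocol N)
    (A B : {set channel N}) : Prop :=
  forall r1 r2 : forall c, value P c, is_run r1 -> is_run r2 ->
    (forall c, c \in A -> r1 c = r2 c) -> forall c, c \in B -> r1 c = r2 c.

(* A loop at [u] is traversed with [v = u], as [set u; u] = [set u]. *)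
Fixpoint walk_from (N : network) (u : party N) (s : seq (channel N)) : bool :=
  if s is c :: s' then
    [exists v, (ends c == [set u; v]) && walk_from v s']
  else true.

Definition is_path (N : network) (s : seq (channel N)) : Prop :=
  exists u, walk_from u s.

Definition gateway (N : network) (G A B : {set channel N}) : Prop :=
  forall c s, is_path (c :: s) -> c \in A -> last c s \in B ->
    exists2 g, g \in c :: s & g \in G.

Inductive formula (N : network) : Type :=
  | Det of {set channel N} & {set channel N}
  | Bot
  | Imp of formula N & formula N.

Arguments Bot {N}.

Declare Scope secret_scope.
Delimit Scope secret_scope with secret.
Bind Scope secret_scope with formula.
Notation "A |> B" := (Det A B) (at level 55, no associativity) : secret_scope.
Notation "phi ~> psi" := (Imp phi psi)
  (at level 60, right associativity) : secret_scope.

Fixpoint eval (N : network) (v : {set channel N} -> {set channel N} -> bool)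
    (phi : formula N) : bool :=
  match phi with
  | Det A B => v A B
  | Bot => false
  | Imp phi1 phi2 => eval v phi1 ==> eval v phi2
  end.

(* The formulas [Det A B] are the propositional atoms. *)
Definition tautology (N : network) (phi : formula N) : Prop :=
  forall v, eval v phi.

Inductive derives (N : network) (X : set (formula N)) : formula N -> Prop :=
  | derives_hyp phi : X phi -> derives X phi
  | derives_taut phi : tautology phi -> derives X phi
  | derives_mp phi psi :
      derives X (phi ~> psi) -> derives X phi -> derives X psi
  | derives_refl (A B : {set channel N}) :
      B \subset A -> derives X (A |> B)
  | derives_aug (A B C : {set channel N}) :
      derives X (A |> B ~> (A :|: C) |> (B :|: C))
  | derives_trans (A B C : {set channel N}) :
      derives X (A |> B ~> B |> C ~> A |> C)
  | derives_gateway (A B G : {set channel N}) :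
      gateway G A B -> derives X (A |> B ~> G |> B).

(* [derives] is not decidable; [`[< _ >]] is its classical truth value. *)
Definition star (N : network) (X : set (formula N)) (E : {set channel N}) :
    {set channel N} :=
  [set c | `[< derives X (E |> [set c]) >]].

Definition P0_value (N : network) (X : set (formula N)) (c : channel N) : Type :=
  {f : {ffun {set channel N} -> bool} |
    [forall E : {set channel N}, (c \in star X E) ==> (f E == false)]}.

Definition P0_local (N : network) (X : set (formula N)) (p : party N)
    (r : forall c : {c : channel N | c \in Inc p}, P0_value X (sval c)) : Prop :=
  forall (E : {set channel N}) (c d : {c : channel N | c \in Inc p}),
    sval c \notin star X E -> sval d \notin star X E ->
    sval (r c) E = sval (r d) E.

Definition P0_semi (N : network) (X : set (formula N)) : semi_protocol N :=
  {| value := P0_value X; local := @P0_local N X |}.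

Lemma P0_has_run (N : network) (X : set (formula N)) :
  exists r, is_run (P := P0_semi X) r.
Proof.
have V0 c : [forall E : {set channel N}, (c \in star X E) ==>
    ([ffun _ : {set channel N} => false] E == false)].
  by apply/forallP => E; rewrite ffunE eqxx implybT.
exists (fun c => exist _ [ffun=> false] (V0 c)).
by move=> p E c d _ _ /=; rewrite !ffunE.
Qed.

Definition P0 (N : network) (X : set (formula N)) : protocol N :=
  Protocol (P0_has_run X).

(* Main.v *)
Require Import Defs.
From mathcomp Require Import all_boot.
From mathcomp Require Import boolp classical_sets.

(** The assignment whose value at [c] and [E] is 1 exactly when [E = A] and
    [c \notin star X A] is a run of [P0 X], because it does not depend on the
    channel outside [star X A].  By Reflexivity it vanishes on [A], so it agrees
    there with the zero run; if [A] determines [B] it vanishes on [B] as well,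
    that is, [B] is contained in [star X A]. *)

Set Implicit Arguments.
Unset Strict Implicit.
Unset Printing Implicit Defensive.

Section Derivations.
Variables (N : network) (X : set (formula N)).
Implicit Types A B C E : {set channel N}.

Lemma in_star E c : reflect (derives X (E |> [set c])) (c \in star X E).
Proof. by rewrite inE; apply: asboolP. Qed.

Lemma subset_star E : E \subset star X E.
Proof.
by apply/fintype.subsetP => c cE; apply/in_star/derives_refl; rewrite finset.sub1set.
Qed.

Lemma derives_augment A B C :
  derives X (A |> B) -> derives X ((A :|: C) |> (B :|: C)).
Proof. exact: derives_mp (derives_aug X A B C). Qed.

Lemma derives_chain B A C :
  derives X (A |> B) -> derives X (B |> C) -> derives X (A |> C).
Proof. by move=> AB; apply/derives_mp/(derives_mp _ AB)/derives_trans. Qed.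

(** Augmenting [A |> C] by [A] gives [A |> (C :|: A)], and augmenting [A |> B] by [C] leads on from
    there to [B :|: C]. *)
Lemma derives_union A B C :
  derives X (A |> B) -> derives X (A |> C) -> derives X (A |> (B :|: C)).
Proof.
move=> AB AC; apply: (@derives_chain (C :|: A)).
  by have := derives_augment A AC; rewrite finset.setUid.
by rewrite [C :|: A]finset.setUC; apply: derives_augment.
Qed.

(** [B] is a finite union of singletons, each derivable from [A]; Reflexivity covers the empty
    union. *)
Lemma derives_sub_star A B : B \subset star X A -> derives X (A |> B).
Proof.
move=> /fintype.subsetP sBA.
have -> : B = \big[@finset.setU _/finset.set0]_(b in B) [set b].
  apply/finset.setP => b; apply/idP/finset.bigcupP => [bB | [c cB]].
    by exists b; rewrite ?finset.set11.
  by move=> /finset.set1P ->.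
apply: (big_ind (fun C => derives X (A |> C))) => [||b /sBA /in_star //].
- exact/derives_refl/finset.sub0set.
- exact: derives_union.
Qed.

End Derivations.

Theorem theorem7 (N : network) (X : set (formula N)) (A B : {set channel N}) :
  determines (P0 X) A B -> derives X (A |> B).
Proof.
move=> detAB; apply/derives_sub_star/fintype.subsetP => b bB.
(* The switch [i] treats both runs at once: [true] gives the run described above, [false] the zero
   run. *)
pose f i c := [ffun E : {set channel N} => [&& i, E == A & c \notin star X E]].
have fV i c :
    [forall E : {set channel N}, (c \in star X E) ==> (f i c E == false)].
  by apply/forallP => E; apply/implyP => cE; rewrite ffunE cE !andbF.
pose r i : forall c, P0_value X c := fun c => exist _ (f i c) (fV i c).
have run_r i : is_run (P := P0 X) (r i).
  by move=> p E c d cE dE /=; rewrite !ffunE cE dE.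
have agreeA c : c \in A -> r true c = r false c.
  move=> cA; apply: val_inj; apply/ffunP => E; rewrite !ffunE /=.
  by case: eqP => // ->; rewrite (fintype.subsetP (subset_star X A)).
have agreeb := detAB _ _ (run_r _) (run_r _) agreeA b bB.
(* At the argument [A] the first run has value [b \notin star X A] and the second has [false]. *)
have := congr1 (fun v : P0_value X b => sval v A) agreeb.
by rewrite /= !ffunE eqxx /= => /negbFE.
Qed.
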